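(* Let $\Omega$ be a bounded Lipschitz domain in $\mathbb{R}^n$ and fix a positive integer $i$. Let $\kappa_i$ be the $i$-th eigenvalue of the boundary mean zero Laplacian with constant Neumann data on $\Omega$ and $\mu_{i+1}$ the $(i+1)$-th Neumann Laplacian eigenvalue on $\Omega$. If there exist some $c\in[\kappa_i,\mu_{i+1}]$ and a solution $u_c$ of $$-\Delta u=cu \ \text{ in } \Omega,\qquad \frac{\partial u}{\partial\nu}=-1\ \text{ on }\partial\Omega$$ such that $\int_{\partial\Omega}u_c\,d\sigma>0$, then $\kappa_i=\mu_{i+1}$.
   Context: $0=\mu_1<\mu_2\le\mu_3\le\cdots\to\infty$ are the Neumann Laplacian eigenvalues of $\Omega$, counted with multiplicity. Let $W(\Omega)=\{w\in H^1(\Omega):\int_{\partial\Omega}w\,d\sigma=0\}$. The eigenvalues $0<\kappa_1\le\kappa_2\le\cdots\to\infty$ of the boundary mean zero Laplacian with constant Neumann data, counted with multiplicity, are $$\kappa_i=\inf\Big\{\frac{\int_\Omega|\nabla w|^2dx}{\int_\Omega w^2dx}: w\in W(\Omega)\setminus\{0\},\ w\perp_{L^2}w_1,\dots,w_{i-1}\Big\}=\min_{L\subset W(\Omega),\,\dim L=i}\ \max_{w\in L\setminus\{0\}}\frac{\int_\Omega|\nabla w|^2dx}{\int_\Omega w^2dx},$$ with $w_j$ an eigenfunction of $\kappa_j$; eigenfunctions satisfy $-\Delta w_i=\kappa_iw_i$ in $\Omega$, $\partial_\nu w_i=-\frac{\kappa_i}{P(\Omega)}\int_\Omega w_i\,dx$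 on $\partial\Omega$, $\int_{\partial\Omega}w_i\,d\sigma=0$, where $P(\Omega)$ is the perimeter. Solutions $u_c$ are weak solutions: $u_c\in H^1(\Omega)$ with $\int_\Omega\nabla u_c\cdot\nabla\varphi\,dx+\int_{\partial\Omega}\varphi\,d\sigma=c\int_\Omega u_c\varphi\,dx$ for all $\varphi\in H^1(\Omega)$. $\nu$ is the outer unit normal, $d\sigma$ surface measure. *)

(* Defs.v *)
(* R^N is 'rV[R]_N with N = n.+1, so every dimension N >= 1
   is covered.  Note that the library norm on 'rV is the sup norm: it is only
   used for topological notions; lengths are measured by [enorm]. *)
From HB Require Import structures.
From mathcomp Require Import all_boot all_order all_algebra.
From mathcomp Require Import all_classical all_reals all_analysis.
Set Implicit Arguments.
Unset Strict Implicit.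
Unset Printing Implicit Defensive.
Import Order.TTheory GRing.Theory Num.Theory.
Import numFieldNormedType.Exports.
Local Open Scope classical_set_scope.
Local Open Scope ring_scope.

Definition dotv (R : realType) (k : nat) (a b : 'rV[R]_k) : R :=
  \sum_(j < k) a 0 j * b 0 j.

Definition enorm (R : realType) (k : nat) (a : 'rV[R]_k) : R :=
  Num.sqrt (dotv a a).

(* Outer measure generated by a gauge [z] defined on all subsets of R^N.  The
   sigma-algebra generated by all sets is the discrete one, so that [mu_ext]
   takes the infimum of \sum_k z (A k) over all countable covers. *)
Definition outer_of (R : realType) (n : nat)
    (z : set 'rV[R]_n.+1 -> \bar R) : set 'rV[R]_n.+1 -> \bar R :=
  mu_ext (z : set (g_sigma_algebraType [set: set 'rV[R]_n.+1]) -> \bar R).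

Section outer_of.
Variables (R : realType) (n : nat) (z : set 'rV[R]_n.+1 -> \bar R).
Let T := g_sigma_algebraType [set: set 'rV[R]_n.+1].

Lemma outer_of_ge0 : (forall A, 0 <= z A)%E -> forall A, (0 <= outer_of z A)%E.
Proof. exact: (@mu_ext_ge0 _ T R z). Qed.

Lemma le_outer_of : {homo outer_of z : A B / A `<=` B >-> (A <= B)%E}.
Proof. exact: (@le_mu_ext _ T R z). Qed.

Lemma outer_of0 : (forall A, 0 <= z A)%E -> z set0 = 0%E ->
  outer_of z set0 = 0%E.
Proof. by move=> z_ge0 z0; exact: (@mu_ext0 _ T R z z0 z_ge0). Qed.

Lemma outer_of_sigma_subadditive : (forall A, 0 <= z A)%E ->
  sigma_subadditive (outer_of z).
Proof. exact: (@mu_ext_sigma_subadditive _ T R z). Qed.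

End outer_of.

Section lebesgue_measure_Rn.
Variables (R : realType) (n : nat).
Local Notation Rn := 'rV[R]_n.+1.
Local Open Scope ereal_scope.

(* volume of the smallest closed box containing A; +oo if A is unbounded *)
Definition box_gauge (A : set Rn) : \bar R :=
  ereal_inf [set (\prod_(j < n.+1) (ab.2 0%R j - ab.1 0%R j)%R)%R%:E
            | ab in [set ab : Rn * Rn |
                (forall j, (ab.1 0 j <= ab.2 0 j)%R) /\
                A `<=` [set x : Rn |
                         forall j, (ab.1 0 j <= x 0 j <= ab.2 0 j)%R]]].

Lemma box_gauge_ge0 A : 0 <= box_gauge A.
Proof.
apply: le_ereal_inf_tmp => _ [[a b] /= [ab _] <-].
by rewrite lee_fin; apply: prodr_ge0 => j _; rewrite subr_ge0.
Qed.

Lemma box_gauge0 : box_gauge set0 = 0.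
Proof.
apply/eqP; rewrite eq_le box_gauge_ge0 andbT.
apply: ereal_inf_lbound; exists (0%R, 0%R) => /=.
  by split => // j; rewrite lexx.
by rewrite big_ord_recl /= subrr mul0r.
Qed.

Definition lebesgue_outer : set Rn -> \bar R := outer_of box_gauge.

HB.instance Definition _ := isOuterMeasure.Build R Rn lebesgue_outer
  (outer_of0 box_gauge_ge0 box_gauge0) (outer_of_ge0 box_gauge_ge0)
  (@le_outer_of _ _ _) (outer_of_sigma_subadditive box_gauge_ge0).

Let mu : {outer_measure set Rn -> \bar R} := lebesgue_outer.

(* R^N with the sigma-algebra of Lebesgue measurable sets *)
Definition lebesgue_space := caratheodory_type mu.

Definition lebesgue_Rn : {measure set lebesgue_space -> \bar R} :=
  mu : set (caratheodory_type mu) -> \bar R.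

End lebesgue_measure_Rn.

Section surface_measure.
Variables (R : realType) (n : nat).
Local Notation Rn := 'rV[R]_n.+1.
Local Open Scope ereal_scope.

Definition ediam (A : set Rn) : \bar R :=
  ereal_sup [set (enorm (xy.1 - xy.2)%R)%:E
            | xy in [set xy : Rn * Rn | A xy.1 /\ A xy.2]].

(* volume of the Euclidean unit ball of R^k *)
Fixpoint ball_volume (k : nat) : R :=
  match k with
  | 0 => 1
  | 1 => 2
  | k'.+2 => 2 * pi / k'.+2%:R * ball_volume k'
  end%R.

Lemma ball_volume_ge0 k : (0 <= ball_volume k)%R.
Proof.
suff : ((0 <= ball_volume k) && (0 <= ball_volume k.+1))%R by case/andP.
elim: k => [|k /andP[h0 h1]]; first by rewrite /= ler01 ler0n.
rewrite h1 /= mulr_ge0// divr_ge0// ?ler0n// mulr_ge0 ?ler0n//.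
exact: pi_ge0.
Qed.

Definition hausdorff_gauge (delta : R) (A : set Rn) : \bar R :=
  if A == set0 then 0
  else if ediam A <= delta%:E
  then (ball_volume n)%:E * (ediam A * (2^-1)%:E) ^+ n
  else +oo.

Lemma hausdorff_gauge_ge0 delta A : 0 <= hausdorff_gauge delta A.
Proof.
rewrite /hausdorff_gauge; case: ifPn => // /set0P[x Ax].
case: ifPn => // _; apply: mule_ge0; first by rewrite lee_fin ball_volume_ge0.
apply: expe_ge0; apply: mule_ge0; last by rewrite lee_fin invr_ge0 ler0n.
apply: (@le_trans _ _ (enorm (x - x)%R)%:E); first by rewrite lee_fin sqrtr_ge0.
by apply: ereal_sup_ubound; exists (x, x).
Qed.

Lemma hausdorff_gauge0 delta : hausdorff_gauge delta set0 = 0.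
Proof. by rewrite /hausdorff_gauge eqxx. Qed.

(* n-dimensional Hausdorff measure on R^(n.+1), normalized so as to give the
   usual surface measure on hypersurfaces (the counting measure if n = 0) *)
Definition hausdorff_outer (A : set Rn) : \bar R :=
  ereal_sup [set outer_of (hausdorff_gauge delta) A
            | delta in [set delta : R | (0 < delta)%R]].

Let ho_le delta A : (0 < delta)%R ->
  outer_of (hausdorff_gauge delta) A <= hausdorff_outer A.
Proof. by move=> d0; apply: ereal_sup_ubound; exists delta. Qed.

Let ho_ge0 A : 0 <= hausdorff_outer A.
Proof.
apply: le_trans (ho_le A ltr01).
exact/outer_of_ge0/hausdorff_gauge_ge0.
Qed.

Let ho0 : hausdorff_outer set0 = 0.
Proof.
apply/eqP; rewrite eq_le ho_ge0 andbT.
apply: ge_ereal_sup => _ [delta _ <-].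
by rewrite outer_of0 ?hausdorff_gauge0//; exact: hausdorff_gauge_ge0.
Qed.

Let ho_mono : {homo hausdorff_outer : A B / A `<=` B >-> A <= B}.
Proof.
move=> A B AB; apply: ge_ereal_sup => _ [delta d0 <-].
apply: le_trans (ho_le B d0).
exact: le_outer_of.
Qed.

Let ho_sub : sigma_subadditive hausdorff_outer.
Proof.
move=> F; apply: ge_ereal_sup => _ [delta d0 <-].
apply: le_trans (outer_of_sigma_subadditive (hausdorff_gauge_ge0 delta) F) _.
apply: lee_nneseries => [k _ _|k _]; last exact: ho_le.
exact/outer_of_ge0/hausdorff_gauge_ge0.
Qed.

HB.instance Definition _ := isOuterMeasure.Build R Rn hausdorff_outer
  ho0 ho_ge0 ho_mono ho_sub.

Let mu : {outer_measure set Rn -> \bar R} := hausdorff_outer.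

(* R^N with the sigma-algebra of Caratheodory measurable sets, which contains
   the Borel sets *)
Definition hausdorff_space := caratheodory_type mu.

Definition surface_measure : {measure set hausdorff_space -> \bar R} :=
  mu : set (caratheodory_type mu) -> \bar R.

End surface_measure.

Section sobolev.
Variables (R : realType) (n : nat).
Local Notation Rn := 'rV[R]_n.+1.
Local Notation leb := (lebesgue_Rn R n).
Local Notation sigma := (surface_measure R n).

Definition bdry (O : set Rn) : set Rn := closure O `\` interior O.

(* Near every boundary point, and up to a linear isometry x |-> x *m Q, the
   open set O is the strict epigraph of a Lipschitz function of the first n
   coordinates. *)
Definition lipschitz_boundary (O : set Rn) : Prop :=
  forall x0, bdry O x0 ->
  exists (U : set Rn) (Q : 'M[R]_n.+1) (gamma : 'rV[R]_n -> R) (K : R),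
    [/\ open U, U x0, Q *m Q^T = 1%:M,
        forall a b, `|gamma a - gamma b| <= K * enorm (a - b) &
        forall x, U x ->
          (O x <-> gamma (col' ord_max (x *m Q)) < (x *m Q) 0 ord_max)].

Definition bounded_lipschitz_domain (O : set Rn) : Prop :=
  [/\ O !=set0, open O, connected O, bounded_set O & lipschitz_boundary O].

Definition partial (k : 'I_n.+1) (f : Rn -> R) : Rn -> R :=
  fun x => 'D_('e_k) f x.

Definition iter_partial (s : seq 'I_n.+1) (f : Rn -> R) : Rn -> R :=
  foldr partial f s.

Definition smooth (f : Rn -> R) : Prop :=
  forall s, continuous (iter_partial s f) /\
    forall k x, derivable (iter_partial s f) x 'e_k.

Definition test_function (O : set Rn) (phi : Rn -> R) : Prop :=
  [/\ smooth phi, compact (closure [set x | phi x != 0]) &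
      closure [set x | phi x != 0] `<=` O].

Definition L2_domain (O : set Rn) (f : Rn -> R) : Prop :=
  measurable_fun (O : set (lebesgue_space R n)) f /\
  leb.-integrable O (fun x => (f x ^+ 2)%:E).

Definition L2_bdry (O : set Rn) (f : Rn -> R) : Prop :=
  measurable_fun (bdry O : set (hausdorff_space R n)) f /\
  sigma.-integrable (bdry O) (fun x => (f x ^+ 2)%:E).

(* A Sobolev function is handled as the pair w = (u, grad u) of a function and
   its weak gradient (which u determines up to a null set). *)
Definition sobpair : Type := ((Rn -> R) * (Rn -> Rn))%type.

Definition H1 (O : set Rn) : set sobpair := [set w : sobpair |
  [/\ L2_domain O w.1,
      forall k, L2_domain O (fun x => w.2 x 0 k) &
      forall phi, test_function O phi -> forall k,
        \int[leb]_(x in O) (w.1 x * partial k phi x) =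
        - \int[leb]_(x in O) (w.2 x 0 k * phi x)]].

Definition dotL2 (O : set Rn) (v w : sobpair) : R :=
  \int[leb]_(x in O) (v.1 x * w.1 x).

Definition dotgrad (O : set Rn) (v w : sobpair) : R :=
  \int[leb]_(x in O) dotv (v.2 x) (w.2 x).

(* tau is the trace of w: the L^2(bdry O)-limit of the restrictions of some
   sequence of smooth functions that converges to w in H^1(O) *)
Definition is_trace (O : set Rn) (w : sobpair) (tau : Rn -> R) : Prop :=
  L2_bdry O tau /\
  exists phi : nat -> Rn -> R,
    [/\ forall m, smooth (phi m),
        (\int[leb]_(x in O) ((phi m x - w.1 x) ^+ 2)%:E)%E
          @[m --> \oo] --> 0%E,
        forall k,
          (\int[leb]_(x in O) ((partial k (phi m) x - w.2 x 0 k) ^+ 2)%:E)%E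
          @[m --> \oo] --> 0%E &
        (\int[sigma]_(x in bdry O) ((phi m x - tau x) ^+ 2)%:E)%E
          @[m --> \oo] --> 0%E].

(* the trace of w in H1 O; it is unique up to a sigma-null set *)
Definition trace (O : set Rn) (w : sobpair) : Rn -> R :=
  xget (cst 0) [set tau | is_trace O w tau].

Definition bdry_integral (O : set Rn) (w : sobpair) : R :=
  \int[sigma]_(x in bdry O) trace O w x.

(* weak solutions of -Delta u = c u in O, d_nu u = -1 on the boundary *)
Definition weak_solution (O : set Rn) (c : R) (u : sobpair) : Prop :=
  H1 O u /\
  forall phi, H1 O phi ->
    dotgrad O u phi + bdry_integral O phi = c * dotL2 O u phi.

Definition neumann_weak_eq (O : set Rn) (lambda : R) (v : sobpair) : Prop :=
  H1 O v /\
  forall phi, H1 O phi -> dotgrad O v phi = lambda * dotL2 O v phi.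

Definition fourier_coef (O : set Rn) (f : Rn -> R) (v : sobpair) : R :=
  \int[leb]_(x in O) (f x * v.1 x).

(* lambda 0 <= lambda 1 <= ... lists the Neumann eigenvalues, each one as many
   times as its multiplicity: they are the eigenvalues of an orthonormal basis
   e of L^2(O) that consists of Neumann eigenfunctions. *)
Definition neumann_eigenbasis (O : set Rn)
    (lambda : nat -> R) (e : nat -> sobpair) : Prop :=
  [/\ {homo lambda : j k / (j <= k)%N >-> j <= k},
      forall k, neumann_weak_eq O (lambda k) (e k),
      forall j k, dotL2 O (e j) (e k) = (j == k)%:R &
      forall f : Rn -> R, L2_domain O f ->
        (\int[leb]_(x in O)
           ((f x - \sum_(k < m) fourier_coef O f (e k) * (e k).1 x) ^+ 2)%:E)%E
        @[m --> \oo] --> 0%E].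

(* mu is the k-th Neumann eigenvalue of O, counted from k = 1 *)
Definition nth_neumann_eigenvalue (O : set Rn) (k : nat) (mu : R) : Prop :=
  (0 < k)%N /\
  exists lambda e, neumann_eigenbasis O lambda e /\ mu = lambda k.-1.

Definition bmz_space (O : set Rn) : set sobpair :=
  [set w : sobpair | H1 O w /\ bdry_integral O w = 0].

Definition lincomb (i : nat) (w : 'I_i -> sobpair) (a : 'rV[R]_i) : sobpair :=
  (fun x => \sum_(j < i) a 0 j * (w j).1 x,
   fun x => \sum_(j < i) a 0 j *: (w j).2 x).

(* w is a basis of an i-dimensional subspace of W(O) *)
Definition bmz_family (O : set Rn) (i : nat) (w : 'I_i -> sobpair) : Prop :=
  (forall a, bmz_space O (lincomb w a)) /\
  (forall a, (lincomb w a).1 = cst 0 %[ae leb in O] -> a = 0).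

Definition rayleigh (O : set Rn) (w : sobpair) : R :=
  dotgrad O w w / dotL2 O w w.

(* i-th eigenvalue (i >= 1) of the boundary mean zero Laplacian with constant
   Neumann data, by the min-max formula *)
Definition bmz_eigenvalue (O : set Rn) (i : nat) : \bar R :=
  ereal_inf [set ereal_sup [set (rayleigh O (lincomb w a))%:E
                           | a in [set a : 'rV[R]_i | a != 0]]
            | w in [set w : 'I_i -> sobpair | bmz_family O w]].

End sobolev.

(* Main.v *)
(* Let b > 0 be the boundary integral of u and Q(v) = |grad v|^2 - c |v|^2.  If
   kappa_i < mu_(i+1), take an i-dimensional L in W(O) whose Rayleigh quotients
   are at most s, for some s > kappa_i.  For w in L the weak formulation
   gives Q(w + t u) = Q(w) - t^2 b, while counting dimensions yields a nonzero
   v = w + t u orthogonal to the first i Neumann eigenfunctions, so that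
   |grad v|^2 >= mu_(i+1) |v|^2.  Then
     (mu_(i+1) - c) |v|^2 + t^2 b <= (s - c) |w|^2,
   and for a suitable s this forces t = 0 and w = 0.  The trace enters only
   through the weak formulation, so none of its properties are needed. *)
Require Import Defs.
From HB Require Import structures.
From mathcomp Require Import all_boot all_order all_algebra.
From mathcomp Require Import all_classical all_reals all_analysis.
From mathcomp Require Import measurable_realfun ring lra.
Set Implicit Arguments.
Unset Strict Implicit.
Unset Printing Implicit Defensive.
Import Order.TTheory GRing.Theory Num.Theory.
Import numFieldNormedType.Exports.
Local Open Scope classical_set_scope.
Local Open Scope ring_scope.

(** * Lebesgue measurability of open sets *)

(** Intersecting a countable cover of [X] with [A] and with its complement covers the two pieces, so
    the splitting inequality passes from the gauge to the outer measure. *)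
Lemma outer_of_caratheodory (R : realType) (n : nat)
    (z : set 'rV[R]_n.+1 -> \bar R) (A : set 'rV[R]_n.+1) :
  (forall X, 0 <= z X)%E ->
  (forall X, z (X `&` A) + z (X `&` ~` A) <= z X)%E ->
  forall X, (outer_of z (X `&` A) + outer_of z (X `&` ~` A) <= outer_of z X)%E.
Proof.
move=> z_ge0 zA X; apply: le_ereal_inf_tmp => _ [F [mF XF] <-].
have cover B : (outer_of z (X `&` B) <= \sum_(k <oo) z (F k `&` B))%E.
  apply: ereal_inf_lbound; exists (fun k => F k `&` B) => //; split.
    by move=> k; exact: sub_gen_smallest.
  by rewrite -setI_bigcupl; exact: setSI.
apply: (le_trans (leeD (cover A) (cover (~` A)))).
rewrite -nneseriesD; [|by move=> *; exact: z_ge0..].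
by apply: lee_nneseries => [k _ _|k _]; [exact: adde_ge0|exact: zA].
Qed.

(** The hyperplane $x_j = t$ cuts a box around [X] into two boxes whose volumes add up to that of
    the box. *)
Lemma box_gauge_halfspace (R : realType) (n : nat) (j : 'I_n.+1) (t : R)
    (X : set 'rV[R]_n.+1) :
  (box_gauge (X `&` [set x | (x 0 j < t)%R]) +
   box_gauge (X `&` ~` [set x | (x 0 j < t)%R]) <= box_gauge X)%E.
Proof.
apply: le_ereal_inf_tmp => _ [[a b] /= [ab Xab] <-].
(* Clamping [t] to the $j$-th side keeps both boxes valid, one of them possibly flat, even when the
   hyperplane misses the box. *)
pose s := Num.min (Num.max t (a 0 j)) (b 0 j).
have /andP[as_ sb] : a 0 j <= s <= b 0 j.
  by rewrite /s le_min ge_min lexx orbT le_max lexx orbT (ab j).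
pose a' : 'rV[R]_n.+1 := \row_k (if k == j then s else a 0 k).
pose b' : 'rV[R]_n.+1 := \row_k (if k == j then s else b 0 k).
apply: (@le_trans _ _ ((\prod_(k < n.+1) (b' 0 k - a 0 k)) +
                       (\prod_(k < n.+1) (b 0 k - a' 0 k)))%:E).
  rewrite EFinD; apply: leeD; apply: ereal_inf_lbound.
    exists (a, b') => //=; split => [k|x [/Xab xab xt] k].
      by rewrite mxE; case: eqP => [->//|].
    rewrite mxE; have /andP[xa xb] := xab k; rewrite xa /=.
    case: eqP => // kj; rewrite kj in xb *.
    by rewrite /s le_min le_max (ltW xt) xb.
  exists (a', b) => //=; split => [k|x [/Xab xab /negP]].
    by rewrite mxE; case: eqP => [->//|].
  rewrite -leNgt => tx k.
  rewrite mxE; have /andP[xa xb] := xab k; rewrite xb andbT.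
  by case: eqP => // kj; rewrite kj in xa *; rewrite /s ge_min ge_max tx xa.
rewrite lee_fin (bigD1 j)//= [X in _ + X](bigD1 j)//= [leRHS](bigD1 j)//=.
rewrite !mxE eqxx.
rewrite (eq_bigr (fun k => b 0 k - a 0 k)); last first.
  by move=> k /negPf kj; rewrite mxE kj.
rewrite [X in _ + _ * X](eq_bigr (fun k => b 0 k - a 0 k)); last first.
  by move=> k /negPf kj; rewrite mxE kj.
by rewrite -mulrDl addrC addrA subrK.
Qed.

Lemma measurable_halfspace (R : realType) (n : nat) (j : 'I_n.+1) (t : R) :
  measurable ([set x : 'rV[R]_n.+1 | x 0 j < t] : set (lebesgue_space R n)).
Proof.
apply: le_caratheodory_measurable => X.
apply: outer_of_caratheodory; first exact: box_gauge_ge0.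
by move=> Y; exact: box_gauge_halfspace.
Qed.

Lemma measurable_coord (R : realType) (n : nat) (j : 'I_n.+1) :
  measurable_fun [set: lebesgue_space R n] (fun x : 'rV[R]_n.+1 => x 0 j).
Proof.
apply: (measurability _ (RGenInftyO.measurableE R)) => _ [_ [t ->] <-].
rewrite setTI; suff -> : (fun x : 'rV[R]_n.+1 => x 0 j) @^-1` `]-oo, t[ =
  [set x | x 0 j < t] by exact: measurable_halfspace.
by apply/seteqP; split => x /=; rewrite in_itv.
Qed.

(** An open set is the countable union of the boxes with rational corners that it contains. *)
Lemma open_lebesgue_measurable (R : realType) (n : nat) (O : set 'rV[R]_n.+1) :
  open O -> measurable (O : set (lebesgue_space R n)).
Proof.
move=> oO.
pose box (p : 'rV[rat]_n.+1 * 'rV[rat]_n.+1) : set 'rV[R]_n.+1 :=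
  [set x | forall j, ratr (p.1 0 j) < x 0 j < ratr (p.2 0 j)].
have mbox p : measurable (box p : set (lebesgue_space R n)).
  rewrite (_ : box p = \bigcap_(j in [set: 'I_n.+1])
      ((fun x => x 0 j) @^-1` `]ratr (p.1 0 j), ratr (p.2 0 j)[)); last first.
    by apply/seteqP; split => x xp j; have := xp j; rewrite /= in_itv//=; exact.
  apply: fin_bigcap_measurable => // j _.
  rewrite -[X in measurable X]setTI.
  exact: measurable_coord.
pose F p := if `[< box p `<=` O >] then box p else set0.
have -> : O = \bigcup_p F p.
  apply/seteqP; split => [x Ox|x [p _]]; last first.
    by rewrite /F; case: ifPn => // /asboolP; exact.
  have /nbhs_ballP[e /= e0 xeO] : nbhs x O by exact: open_nbhs_nbhs.
  have lo j : {q : rat | x 0 j - e < ratr q < x 0 j}.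
    apply: cid; have /rat_in_itvoo[q] : x 0 j - e < x 0 j.
      by rewrite ltrBlDr ltrDl.
    by rewrite in_itv /= => ?; exists q.
  have hi j : {q : rat | x 0 j < ratr q < x 0 j + e}.
    apply: cid; have /rat_in_itvoo[q] : x 0 j < x 0 j + e by rewrite ltrDl.
    by rewrite in_itv /= => ?; exists q.
  exists (\row_j sval (lo j), \row_j sval (hi j)) => //.
  rewrite /F; case: ifPn => [_ j|/asboolP[]] /=.
    rewrite !mxE.
    by have [/andP[_ ->] /andP[-> _]] := (svalP (lo j), svalP (hi j)).
  move=> y yb; apply: xeO; split => // i j; rewrite (ord1 i).
  have := yb j; rewrite /= !mxE => /andP[qy yr].
  have [/andP[ql _] /andP[_ rh]] := (svalP (lo j), svalP (hi j)).
  rewrite -ball_normE /= ltr_distlC; apply/andP; split.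
    exact: lt_trans ql qy.
  exact: lt_trans yr rh.
apply: countable_bigcupT_measurable => [|p]; first exact: countableP.
by rewrite /F; case: ifP.
Qed.

(** * Sobolev pairs and symmetric bilinear forms on them *)

Lemma L2_domain_integrableM (R : realType) (n : nat) (O : set 'rV[R]_n.+1)
    (f g : 'rV[R]_n.+1 -> R) : open O -> L2_domain O f -> L2_domain O g ->
  (lebesgue_Rn R n).-integrable O (fun x => (f x * g x)%:E).
Proof.
move=> /open_lebesgue_measurable mO [mf f2] [mg g2].
apply: (le_integrable mO _ _ (integrableD mO f2 g2)).
  by apply/measurable_EFinP; exact: measurable_funM.
move=> x _ /=; rewrite lee_fin [leRHS]ger0_norm ?addr_ge0 ?sqr_ge0//.
rewrite -real_normK ?num_real// -(real_normK (num_real (g x))) normrM.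
have := sqr_ge0 (`|f x| - `|g x|); have := normr_ge0 (f x).
by have := normr_ge0 (g x); nra.
Qed.

Lemma L2_domain_axpy (R : realType) (n : nat) (O : set 'rV[R]_n.+1)
    (f g : 'rV[R]_n.+1 -> R) (t : R) :
  open O -> L2_domain O f -> L2_domain O g ->
  L2_domain O (fun x => t * f x + g x).
Proof.
move=> oO Lf Lg; have mO := open_lebesgue_measurable oO.
have [[mf f2] [mg g2]] := (Lf, Lg); split.
  exact: (measurable_funD (measurable_funM (measurable_cst t) mf) mg).
have fg := L2_domain_integrableM oO Lf Lg.
have := integrableD mO (integrableZl mO (t ^+ 2) f2)
  (integrableD mO (integrableZl mO (t *+ 2) fg) g2).
congr (_.-integrable _ _); apply/funext => x /=.
by rewrite -!EFinM -!EFinD; congr EFin; ring.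
Qed.

Lemma L2_domain0 (R : realType) (n : nat) (O : set 'rV[R]_n.+1) :
  open O -> L2_domain O (cst 0).
Proof.
move=> /open_lebesgue_measurable mO; split; first exact: measurable_cst.
rewrite (_ : (fun x => _) = cst 0%E); first exact: integrable0.
by apply/funext => x /=; rewrite expr0n.
Qed.

(** Keeps only the integrability half of [H1]: this makes the integral forms bilinear, and its
    stability under linear combinations needs no integration by parts. *)
Definition sobL2 (R : realType) (n : nat) (O : set 'rV[R]_n.+1)
    (w : sobpair R n) : Prop :=
  L2_domain O w.1 /\ forall k, L2_domain O (fun x => w.2 x 0 k).

Lemma H1_sobL2 (R : realType) (n : nat) (O : set 'rV[R]_n.+1)
  (w : sobpair R n) : H1 O w -> sobL2 O w.
Proof. by case. Qed.

Definition sob_axpy (R : realType) (n : nat) (t : R) (u w : sobpair R n) :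
  sobpair R n :=
  (fun x => t * u.1 x + w.1 x, fun x => t *: u.2 x + w.2 x).

Lemma lincomb_recl (R : realType) (n i : nat) (w : 'I_i.+1 -> sobpair R n)
    (a : 'rV[R]_i.+1) :
  lincomb w a = sob_axpy (a 0 ord0) (w ord0)
    (lincomb (fun j => w (lift ord0 j)) (\row_j a 0 (lift ord0 j))).
Proof.
by congr pair; apply/funext => x; rewrite big_ord_recl/=; congr (_ + _);
  apply: eq_bigr => j _; rewrite mxE.
Qed.

Lemma sobL2_axpy (R : realType) (n : nat) (O : set 'rV[R]_n.+1) (t : R)
    (u w : sobpair R n) :
  open O -> sobL2 O u -> sobL2 O w -> sobL2 O (sob_axpy t u w).
Proof.
move=> oO [u1 u2] [w1 w2]; split; first exact: L2_domain_axpy.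
move=> k; have := L2_domain_axpy t oO (u2 k) (w2 k).
by congr L2_domain; apply/funext => x; rewrite !mxE.
Qed.

Lemma lincomb0 (R : realType) (n : nat) (w : 'I_0 -> sobpair R n)
  (a : 'rV[R]_0) : lincomb w a = (cst 0, cst 0).
Proof. by congr pair; apply/funext => x; rewrite big_ord0. Qed.

Lemma sobL2_lincomb (R : realType) (n : nat) (O : set 'rV[R]_n.+1) (i : nat)
    (w : 'I_i -> sobpair R n) (a : 'rV[R]_i) :
  open O -> (forall j, sobL2 O (w j)) -> sobL2 O (lincomb w a).
Proof.
move=> oO; elim: i w a => [|i IH] w a Lw.
  rewrite lincomb0; split => [|k]; first exact: L2_domain0.
  rewrite (_ : (fun x => _) = cst 0); first exact: L2_domain0.
  by apply/funext => x; rewrite mxE.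
rewrite lincomb_recl; apply: (sobL2_axpy _ oO (Lw ord0)).
by apply: IH => j; exact: Lw.
Qed.

(** Common interface of [dotL2] and [dotgrad], so that expansions are proved once. Linearity is
    restricted to [sobL2] because integrals add up only for integrable functions. *)
Definition sobform (R : realType) (n : nat) (O : set 'rV[R]_n.+1)
    (B : sobpair R n -> sobpair R n -> R) : Prop :=
  (forall v w, B v w = B w v) /\
  (forall z u w t, sobL2 O z -> sobL2 O u -> sobL2 O w ->
     B z (sob_axpy t u w) = t * B z u + B z w).

Lemma sobform_axpy_axpy (R : realType) (n : nat) (O : set 'rV[R]_n.+1)
    (B : sobpair R n -> sobpair R n -> R) (t : R) (u w : sobpair R n) :
  open O -> sobform O B -> sobL2 O u -> sobL2 O w ->
  B (sob_axpy t u w) (sob_axpy t u w) =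
  t ^+ 2 * B u u + t *+ 2 * B u w + B w w.
Proof.
move=> oO [Bsym Baxpy] Lu Lw; have Luw := sobL2_axpy t oO Lu Lw.
by rewrite Baxpy// !(Bsym (sob_axpy t u w)) !Baxpy// (Bsym w u); ring.
Qed.

Lemma sobform_lincomb (R : realType) (n : nat) (O : set 'rV[R]_n.+1)
    (B : sobpair R n -> sobpair R n -> R) (z : sobpair R n) (i : nat)
    (w : 'I_i -> sobpair R n) (a : 'rV[R]_i) :
  open O -> sobform O B -> sobL2 O z -> (forall j, sobL2 O (w j)) ->
  B z (lincomb w a) = \sum_(j < i) a 0 j * B z (w j).
Proof.
move=> oO BF Lz; have [_ Baxpy] := BF.
elim: i w a => [|i IH] w a Lw; last first.
  have Lw' j : sobL2 O (w (lift ord0 j)) by exact: Lw.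
  rewrite lincomb_recl (Baxpy _ _ _ _ Lz (Lw ord0) (sobL2_lincomb _ oO Lw')).
  rewrite (IH _ _ Lw') big_ord_recl; congr (_ + _).
  by apply: eq_bigr => j _; rewrite mxE.
(* Empty combination: the zero pair is written as $-z + z$, so that linearity in the second argument
   gives the value 0. *)
rewrite big_ord0 lincomb0 (_ : (_, _) = sob_axpy (-1) z z).
  by rewrite Baxpy// mulN1r addNr.
by congr pair; apply/funext => x /=; rewrite ?mulN1r ?scaleN1r addNr.
Qed.

Lemma dotL2_sobform (R : realType) (n : nat) (O : set 'rV[R]_n.+1) :
  open O -> sobform O (dotL2 O).
Proof.
move=> oO; have mO := open_lebesgue_measurable oO; split=> [v w|].
  by rewrite /dotL2; under eq_Rintegral do rewrite mulrC.
move=> z u w t [Lz _] [Lu _] [Lw _]; rewrite /dotL2 /=.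
have izu := L2_domain_integrableM oO Lz Lu.
have izw := L2_domain_integrableM oO Lz Lw.
rewrite -(RintegralZl t mO izu) -(RintegralD mO (integrableZl mO t izu) izw).
by apply: eq_Rintegral => x _; ring.
Qed.

Lemma dotgrad_integrable (R : realType) (n : nat) (O : set 'rV[R]_n.+1)
    (v w : sobpair R n) : open O -> sobL2 O v -> sobL2 O w ->
  (lebesgue_Rn R n).-integrable O (fun x => (dotv (v.2 x) (w.2 x))%:E).
Proof.
move=> oO [_ Lv] [_ Lw]; have mO := open_lebesgue_measurable oO.
under eq_fun do rewrite /dotv -sumEFin.
apply: integrable_sum => // k _; exact: L2_domain_integrableM.
Qed.

Lemma dotgrad_sobform (R : realType) (n : nat) (O : set 'rV[R]_n.+1) :
  open O -> sobform O (dotgrad O).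
Proof.
move=> oO; have mO := open_lebesgue_measurable oO; split=> [v w|].
  rewrite /dotgrad; apply: eq_Rintegral => x _.
  by apply: eq_bigr => k _; rewrite mulrC.
move=> z u w t Lz Lu Lw; rewrite /dotgrad /=.
have izu := dotgrad_integrable oO Lz Lu.
have izw := dotgrad_integrable oO Lz Lw.
rewrite -(RintegralZl t mO izu) -(RintegralD mO (integrableZl mO t izu) izw).
apply: eq_Rintegral => x _; rewrite mulr_sumr -big_split/=.
by apply: eq_bigr => k _; rewrite !mxE; ring.
Qed.

(** * Positivity and the spectral lower bound for the Neumann Rayleigh quotient *)

Lemma dotL2_ge0 (R : realType) (n : nat) (O : set 'rV[R]_n.+1)
  (v : sobpair R n) : 0 <= dotL2 O v v.
Proof. by apply: Rintegral_ge0 => x _; rewrite -expr2 sqr_ge0. Qed.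

Lemma dotgrad_ge0 (R : realType) (n : nat) (O : set 'rV[R]_n.+1)
  (v : sobpair R n) : 0 <= dotgrad O v v.
Proof.
apply: Rintegral_ge0 => x _; apply: sumr_ge0 => k _.
by rewrite -expr2 sqr_ge0.
Qed.

Lemma dotL2_eq0 (R : realType) (n : nat) (O : set 'rV[R]_n.+1)
    (v : sobpair R n) : open O -> L2_domain O v.1 -> dotL2 O v v = 0 ->
  v.1 = cst 0 %[ae lebesgue_Rn R n in O].
Proof.
move=> oO Lv v0; have mO := open_lebesgue_measurable oO.
have iv := L2_domain_integrableM oO Lv Lv.
have int0 : (\int[lebesgue_Rn R n]_(x in O) `|(v.1 x * v.1 x)%:E| = 0)%E.
  rewrite (eq_integral (fun x : lebesgue_space R n => (v.1 x * v.1 x)%:E));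
    last first.
    by move=> x _; rewrite /= ger0_norm// -expr2 sqr_ge0.
  by rewrite -[LHS]fineK; [rewrite -[0%E]/0%:E -v0|exact: integrable_fin_num].
have /integrableP[miv _] := iv.
have : (lebesgue_Rn R n).-negligible
    (~` [set x | O x -> (v.1 x * v.1 x)%:E = 0%E]).
  exact: (ae_eq_integral_abs _ mO miv).1 int0.
apply: negligibleS => x; apply: contra_not => vx Ox; have [/eqP] := vx Ox.
by rewrite mulf_eq0 orbb => /eqP.
Qed.

(* The bound is the limit of 0 <= |grad (v - P_m v)|^2, with P_m the orthogonal
   projection on the first m eigenfunctions: completeness of the basis makes
   any compactness argument unnecessary. *)
Lemma neumann_rayleigh_ge (R : realType) (n : nat) (O : set 'rV[R]_n.+1)
    (lambda : nat -> R) (e : nat -> sobpair R n) (i : nat) (v : sobpair R n) :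
  open O -> neumann_eigenbasis O lambda e -> sobL2 O v ->
  (forall k, dotgrad O (e k) v = lambda k * dotL2 O (e k) v) ->
  (forall k, (k < i)%N -> dotL2 O (e k) v = 0) ->
  lambda i * dotL2 O v v <= dotgrad O v v.
Proof.
move=> oO [lambda_homo eigen ortho complete] Lv ev v_ortho.
have Le k : sobL2 O (e k) by have [/H1_sobL2] := eigen k.
have FN := dotL2_sobform oO; have FG := dotgrad_sobform oO.
pose c k := dotL2 O (e k) v.
pose P m := lincomb (fun k : 'I_m => e k) (\row_k c k).
have LP m : sobL2 O (P m) by apply: sobL2_lincomb.
pose r m := sob_axpy (-1) (P m) v.
(* Pythagoras for both forms at once: the eigenfunctions are orthogonal for each of them, with
   squared norms [mult k] equal to 1 for [dotL2] and to [lambda k] for [dotgrad]. *)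
have resid B mult m : sobform O B ->
    (forall k, B (e k) v = mult k * c k) ->
    (forall j k, B (e j) (e k) = mult j * (j == k)%:R) ->
    B (r m) (r m) = B v v - \sum_(k < m) mult k * c k ^+ 2.
  move=> FB Bv Be; have [Bsym _] := FB.
  have BPv : B (P m) v = \sum_(k < m) mult k * c k ^+ 2.
    rewrite Bsym (sobform_lincomb _ oO FB Lv); last by move=> k; exact: Le.
    by apply: eq_bigr => k _; rewrite mxE Bsym Bv; ring.
  have BPP : B (P m) (P m) = \sum_(k < m) mult k * c k ^+ 2.
    rewrite (sobform_lincomb _ oO FB (LP m)); last by move=> k; exact: Le.
    apply: eq_bigr => k _; rewrite mxE Bsym.
    rewrite (sobform_lincomb _ oO FB (Le k)); last by move=> j; exact: Le.
    rewrite (bigD1 k)//= big1 ?addr0 => [|j jk].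
      by rewrite mxE Be eqxx mulr1; ring.
    by rewrite Be eq_sym (inj_eq val_inj) (negPf jk) !mulr0.
  rewrite (sobform_axpy_axpy _ oO FB (LP m) Lv) BPP BPv; ring.
have residN m : dotL2 O (r m) (r m) = dotL2 O v v - \sum_(k < m) c k ^+ 2.
  rewrite (resid _ (fun=> 1))//.
  - by under eq_bigr do rewrite mul1r.
  - by move=> k; rewrite mul1r.
  - by move=> j k; rewrite ortho mul1r.
have residG m : dotgrad O (r m) (r m) =
    dotgrad O v v - \sum_(k < m) lambda k * c k ^+ 2.
  apply: resid => // j k.
  have [Hek _] := eigen k; have [_ ej] := eigen j.
  by rewrite ej// ortho.
have bound m : lambda i * (dotL2 O v v - dotL2 O (r m) (r m)) <= dotgrad O v v.
  rewrite residN opprB addrC subrK.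
  (* Bessel's inequality for the gradient form bounds the sum; in it, terms with $k < i$ vanish by
     orthogonality and the others have [lambda k] at least [lambda i]. *)
  apply: (@le_trans _ _ (\sum_(k < m) lambda k * c k ^+ 2)); last first.
    by rewrite -subr_ge0 -residG dotgrad_ge0.
  rewrite mulr_sumr; apply: ler_sum => k _.
  have [ki|ik] := ltnP k i; first by rewrite /c v_ortho// expr0n !mulr0.
  by rewrite ler_wpM2r ?sqr_ge0// lambda_homo.
have rE m : dotL2 O (r m) (r m) = \int[lebesgue_Rn R n]_(x in O)
    ((v.1 x - \sum_(k < m) fourier_coef O v.1 (e k) * (e k).1 x) ^+ 2).
  apply: eq_Rintegral => x _; rewrite /= -expr2 mulN1r addrC.
  congr ((_ - _) ^+ 2); apply: eq_bigr => k _; rewrite mxE; congr (_ * _).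
  by apply: eq_Rintegral => y _; rewrite mulrC.
have rto0 : dotL2 O (r m) (r m) @[m --> \oo] --> 0.
  by under eq_fun do rewrite rE; exact: (fine_cvg (complete _ Lv.1)).
have lim : lambda i * (dotL2 O v v - dotL2 O (r m) (r m)) @[m --> \oo] -->
    lambda i * (dotL2 O v v - 0).
  by apply: cvgMr; apply: cvgB rto0; exact: cvg_cst.
rewrite subr0 in lim.
by apply: (cvgr_to_le lim); apply: nearW.
Qed.

(** * A test vector orthogonal to the first Neumann eigenfunctions *)

(** Recovers the members of a family from its combinations, as [bmz_family] asserts membership in
    $W(O)$ only for the latter. *)
Lemma lincomb_delta (R : realType) (n i : nat) (w : 'I_i -> sobpair R n)
  (j : 'I_i) : lincomb w (delta_mx 0 j) = w j.
Proof.
rewrite [RHS]surjective_pairing; congr pair; apply/funext => x;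
  rewrite (bigD1 j)//= big1 ?addr0 => [|k /negPf kj].
- by rewrite mxE !eqxx mul1r.
- by rewrite mxE kj andbF mul0r.
- by rewrite mxE !eqxx scale1r.
- by rewrite mxE kj andbF scale0r.
Qed.

(** With more rows than columns, the rows are linearly dependent. *)
Lemma exists_row_mul0 (F : fieldType) (i : nat) (M : 'M[F]_(i.+1, i)) :
  exists2 x : 'rV[F]_i.+1, x != 0 & x *m M = 0.
Proof.
have : kermx M != 0.
  by rewrite kermx_eq0 -row_leq_rank -ltnNge ltnS rank_leq_col.
by case/rowV0Pn => x /sub_kermxP xM x0; exists x.
Qed.

Section test_vector.
Context (R : realType) (n : nat) (O : set 'rV[R]_n.+1) (oO : open O).
Context (c : R) (u : sobpair R n) (Hu : weak_solution O c u).
Context (i : nat) (w : 'I_i -> sobpair R n) (Hw : bmz_family O w).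

Let Lu : sobL2 O u. Proof. by case: Hu => /H1_sobL2. Qed.

Lemma bmz_family_sobL2 j : sobL2 O (w j).
Proof. by rewrite -lincomb_delta; case: (Hw.1 (delta_mx 0 j)) => /H1_sobL2. Qed.

Lemma bmz_family_eq0 a : dotL2 O (lincomb w a) (lincomb w a) = 0 -> a = 0.
Proof.
move=> wa0; apply: Hw.2; apply: dotL2_eq0 => //.
by have [/H1_sobL2[]] := Hw.1 a.
Qed.

(* The weak formulation tested with w in W(O) and with u turns all boundary
   terms of the quadratic form into - t^2 \int_{bdry O} u. *)
Lemma quadratic_form_axpy t a :
  let z := lincomb w a in let v := sob_axpy t u z in
  dotgrad O v v - c * dotL2 O v v =
  dotgrad O z z - c * dotL2 O z z - t ^+ 2 * bdry_integral O u.
Proof.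
move=> z v; have [Hz bz] := Hw.1 a; have [H1u weak] := Hu.
have FN := dotL2_sobform oO; have FG := dotgrad_sobform oO.
rewrite (sobform_axpy_axpy _ oO FN Lu (H1_sobL2 Hz)).
rewrite (sobform_axpy_axpy _ oO FG Lu (H1_sobL2 Hz)).
have := weak _ Hz; rewrite bz addr0 => ->.
have /eqP := weak _ H1u; rewrite eq_sym -subr_eq => /eqP <-.
by ring.
Qed.

(** The $i+1$ pairs [u], [w j] face $i$ orthogonality conditions, so some nonzero coefficient vector
    meets them all. Only the coefficients are claimed nonzero, not [v]. As [lambda] starts at index
    0, [lambda i] is $\mu_{i+1}$. *)
Lemma exists_test_vector (lambda : nat -> R) (e : nat -> sobpair R n) :
  neumann_eigenbasis O lambda e ->
  exists t a, (t != 0) || (a != 0) /\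
    let v := sob_axpy t u (lincomb w a) in
    lambda i * dotL2 O v v <= dotgrad O v v.
Proof.
move=> basis; have [_ eigen _ _] := basis.
pose W (k : 'I_i.+1) := oapp w u (unlift ord0 k).
have W0 : W ord0 = u by rewrite /W unlift_none.
have WS : (fun j => W (lift ord0 j)) = w.
  by apply/funext => j; rewrite /W liftK.
have LW k : sobL2 O (W k).
  rewrite /W; case: unliftP => [j _|_]; first exact: (bmz_family_sobL2 j).
  exact: Lu.
have [x x0 xM] :=
  exists_row_mul0 (\matrix_(r < i.+1, k < i) dotL2 O (e k) (W r)).
pose a : 'rV[R]_i := \row_j x 0 (lift ord0 j).
have vE : lincomb W x = sob_axpy (x 0 ord0) u (lincomb w a).
  by rewrite lincomb_recl W0 WS.
have Le k : sobL2 O (e k) by have [/H1_sobL2] := eigen k.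
exists (x 0 ord0), a; split.
  apply: contraNT x0; rewrite negb_or !negbK => /andP[/eqP x00 /eqP a0].
  apply/eqP/rowP => k; rewrite mxE; case: (unliftP ord0 k) => [j ->|->] //.
  by move/rowP: a0 => /(_ j); rewrite !mxE.
rewrite /= -vE; apply: (neumann_rayleigh_ge oO basis).
- exact: sobL2_lincomb.
(* The eigenfunction equation is tested with each [W j] in [H1] and then summed, which avoids
   showing that the combination is in [H1]. *)
- have FN := dotL2_sobform oO; have FG := dotgrad_sobform oO.
  move=> k; rewrite (sobform_lincomb _ oO FN (Le k) LW).
  rewrite (sobform_lincomb _ oO FG (Le k) LW).
  rewrite mulr_sumr; apply: eq_bigr => j _; rewrite mulrCA; congr (_ * _).
  have [_ ek] := eigen k; apply: ek.
  rewrite /W; case: unliftP => [l _|_] /=; last by case: Hu.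
  by rewrite -lincomb_delta; case: (Hw.1 (delta_mx 0 l)).
- move=> k ki; rewrite (sobform_lincomb _ oO (dotL2_sobform oO) (Le k) LW).
  have /rowP/(_ (Ordinal ki)) := xM; rewrite !mxE => xk.
  by rewrite -[RHS]xk; apply: eq_bigr => j _; rewrite mxE.
Qed.

End test_vector.

(** * Near-optimal subspaces, choice of the threshold, and conclusion *)

(** Since [s] exceeds the infimum, some family has all its Rayleigh quotients below [s]. Clearing
    the denominator lets the bound include [a = 0]. *)
Lemma bmz_eigenvalue_lt (R : realType) (n : nat) (O : set 'rV[R]_n.+1)
    (i : nat) (s : R) : open O -> (bmz_eigenvalue O i < s%:E)%E ->
  exists w : 'I_i -> sobpair R n, bmz_family O w /\ forall a,
    dotgrad O (lincomb w a) (lincomb w a) <=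
    s * dotL2 O (lincomb w a) (lincomb w a).
Proof.
move=> oO /ereal_inf_lt[_ [w Hw <-]] sup_lt; exists w; split => // a.
have [->|a0] := eqVneq a 0.
  have Lw0 := H1_sobL2 (Hw.1 0).1; have Lw := bmz_family_sobL2 Hw.
  rewrite (sobform_lincomb _ oO (dotL2_sobform oO) Lw0 Lw).
  rewrite (sobform_lincomb _ oO (dotgrad_sobform oO) Lw0 Lw).
  by rewrite !big1 ?mulr0// => j _; rewrite mxE mul0r.
have N0 : 0 < dotL2 O (lincomb w a) (lincomb w a).
  rewrite lt_def dotL2_ge0 andbT; apply: contra_neq a0.
  exact: (bmz_family_eq0 oO Hw).
rewrite -ler_pdivrMr// -lee_fin; apply: ltW; apply: le_lt_trans sup_lt.
by apply: ereal_sup_ubound; exists a.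
Qed.

(* If c = mu, any s between kappa and mu works.  If c < mu, s = c + eps works
   because eps |w|^2 is absorbed by half of the left-hand side. *)
Lemma exists_threshold (R : realType) (kappa : \bar R) (c mu b Nu : R) :
  (kappa <= c%:E)%E -> c <= mu -> (kappa < mu%:E)%E -> 0 < b -> 0 <= Nu ->
  exists2 s, (kappa < s%:E)%E & forall t Nv Nw,
    0 <= Nv -> 0 <= Nw -> Nw <= 2 * Nv + 2 * t ^+ 2 * Nu ->
    (mu - c) * Nv + t ^+ 2 * b <= (s - c) * Nw -> t = 0 /\ Nw = 0.
Proof.
move=> kc + kmu b0 Nu0; rewrite le_eqVlt => /predU1P[cE|cmu].
  have [s ks smu] : exists2 s, (kappa < s%:E)%E & s < mu.
    (* An extended real below [mu] is finite or $-\infty$: take the midpoint or [mu - 1]. *)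
    case: kappa kmu {kc} => [k| |] //=; last first.
      by exists (mu - 1); [exact: ltNyr|rewrite ltrBlDr ltrDl].
    by rewrite lte_fin => /midf_lt[]; exists ((k + mu) / 2).
  exists s => // t Nv Nw Nv0 Nw0 _; rewrite cE subrr mul0r add0r => h.
  have Nw00 : Nw = 0.
    apply/le_anti; rewrite Nw0 andbT -(nmulr_rge0 Nw (x := s - mu)) ?subr_lt0//.
    by apply: le_trans h; rewrite mulr_ge0 ?sqr_ge0// ltW.
  split => //; apply/eqP; rewrite -sqrf_eq0 eq_le sqr_ge0 andbT.
  by rewrite -(pmulr_lle0 _ b0); move: h; rewrite Nw00 mulr0.
(* The two bounds absorb the terms $2\,Nv$ and $2t^2 Nu$ respectively; $Nu + 1$ keeps the
   denominator positive when $Nu = 0$. *)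
pose eps := Num.min ((mu - c) / 4) (b / (4 * (Nu + 1))).
have eps0 : 0 < eps.
  by rewrite lt_min !divr_gt0 ?subr_gt0// mulr_gt0// ltr_wpDl.
have eps1 : eps <= (mu - c) / 4 by rewrite ge_min lexx.
have eps2 : eps * Nu <= b / 4.
  have : eps <= b / (4 * (Nu + 1)) by rewrite ge_min lexx orbT.
  by rewrite ler_pdivlMr ?mulr_gt0 ?ltr_wpDl//; nra.
exists (c + eps); first by apply: (le_lt_trans kc); rewrite lte_fin ltrDl.
move=> t Nv Nw Nv0 Nw0 NwNv h; have t20 := sqr_ge0 t.
have half : (mu - c) * Nv + t ^+ 2 * b <= (mu - c) / 2 * Nv + t ^+ 2 * (b / 2).
  apply: (le_trans h); rewrite addrAC subrr add0r.
  apply: (@le_trans _ _ (eps * (2 * Nv + 2 * t ^+ 2 * Nu))).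
    by rewrite ler_pM2l.
  have : eps * Nv <= (mu - c) / 4 * Nv by rewrite ler_wpM2r.
  have : t ^+ 2 * (eps * Nu) <= t ^+ 2 * (b / 4) by rewrite ler_wpM2l.
  lra.
have tb : 0 <= t ^+ 2 * b by rewrite mulr_ge0// ltW.
have cNv : 0 <= (mu - c) * Nv by rewrite mulr_ge0// subr_ge0 ltW.
have t0 : t = 0.
  apply/eqP; rewrite -sqrf_eq0 eq_le t20 andbT -(pmulr_lle0 _ b0); lra.
have Nv00 : Nv = 0.
  apply/le_anti; rewrite Nv0 andbT -(pmulr_rle0 Nv (x := mu - c)) ?subr_gt0//.
  by lra.
split => //; apply/le_anti; rewrite Nw0 andbT.
by move: NwNv; rewrite t0 Nv00; lra.
Qed.

Theorem proposition1p6 (R : realType) (n : nat) (Omega : set 'rV[R]_n.+1)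
    (hOmega : bounded_lipschitz_domain Omega) (i : nat) (hi : (0 < i)%N)
    (mu : R) (hmu : nth_neumann_eigenvalue Omega i.+1 mu) :
  (exists (c : R) (u : sobpair R n),
     [/\ (bmz_eigenvalue Omega i <= c%:E)%E, c <= mu,
         weak_solution Omega c u & 0 < bdry_integral Omega u]) ->
  bmz_eigenvalue Omega i = mu%:E.
Proof.
move=> [c [u [kc cmu Hu b0]]].
have [_ oO _ _ _] := hOmega.
have [_ [lambda [e [basis muE]]]] := hmu; rewrite /= in muE.
(* Going through [c] already gives $\kappa_i \le \mu_{i+1}$; it remains to refute strict
   inequality. *)
apply/eqP; rewrite eq_le (le_trans kc) ?lee_fin//= leNgt; apply/negP => kmu.
have LN z : 0 <= dotL2 Omega z z by exact: dotL2_ge0.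
have [s ks s_spec] := exists_threshold kc cmu kmu b0 (LN u).
have [w [Hw wle]] := bmz_eigenvalue_lt oO ks.
have [t [a [ta /= vle]]] := exists_test_vector oO Hu Hw basis.
have /= quad := quadratic_form_axpy oO Hu Hw t a.
have Lu : sobL2 Omega u by case: Hu => /H1_sobL2.
have Lz : sobL2 Omega (lincomb w a) by case: (Hw.1 a) => /H1_sobL2.
have NvE tau := sobform_axpy_axpy tau oO (dotL2_sobform oO) Lu Lz.
have [] := s_spec t _ _ (LN (sob_axpy t u (lincomb w a))) (LN (lincomb w a)).
- (* |w|^2 <= 2 |v|^2 + 2 t^2 |u|^2, the difference being |w + 2 t u|^2 *)
  by have := LN (sob_axpy (2 * t) u (lincomb w a)); rewrite !NvE; lra.
- by rewrite -muE in vle; have := wle a; lra.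
(* With $t = 0$ the coefficients [a] must be nonzero, while a vanishing norm and linear independence
   force [a = 0]. *)
move=> t0 Nw0; move: ta; rewrite t0 eqxx /= => /eqP; apply.
exact: (bmz_family_eq0 oO Hw Nw0).
Qed.
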